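(* Let $G$ be a $\sigma$-compact subgroup of $\mathbb R$ and let $f:G\to G$ be a continuous involution with exactly one fixed point. Then there exists a group operation $\oplus$ on $G$ such that $G'=\langle G,\oplus\rangle$ is topologically isomorphic to $G$ and $f$ is the inversion in $G'$.
   Context: $\mathbb R$ is the topological additive group of real numbers with the Euclidean topology, and subgroups carry the subspace topology. An involution is a map $f$ with $f\circ f=\mathrm{id}$. For a group operation $\oplus$ on the underlying set of $G$, $\langle G,\oplus\rangle$ denotes the underlying topological space of $G$ (with its topology unchanged) equipped with the operation $\oplus$. Two topological groups are topologically isomorphic if there is a group isomorphism between them that is also a homeomorphism. The inversion in a group is the map sending each element to its inverse. *)

(* Defs.v *)
From HB Require Import structures.
From mathcomp Require Import all_boot all_order all_algebra.
From mathcomp Require Import all_classical all_reals all_analysis.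

Set Implicit Arguments.
Unset Strict Implicit.
Unset Printing Implicit Defensive.

Import Order.TTheory GRing.Theory Num.Theory.
Import numFieldNormedType.Exports.

Local Open Scope classical_set_scope.
Local Open Scope ring_scope.

Definition sigma_compact (T : topologicalType) (A : set T) : Prop :=
  exists K : nat -> set T, (forall n, compact (K n)) /\ A = \bigcup_n K n.

(* As groups here may be non-abelian, the additive topologicalZmodType of the
   library does not apply. *)
Record is_topological_group (T : topologicalType)
    (op : T -> T -> T) (e : T) (inv : T -> T) : Prop := {
  tgroup_opA : associative op;
  tgroup_op1g : left_id e op;
  tgroup_opg1 : right_id e op;
  tgroup_opVg : left_inverse e inv op;
  tgroup_opgV : right_inverse e inv op;
  tgroup_op_continuous : continuous (fun z : T * T => op z.1 z.2);
  tgroup_inv_continuous : continuous inv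
}.

Definition topologically_isomorphic (T U : topologicalType)
    (opT : T -> T -> T) (opU : U -> U -> U) : Prop :=
  exists (phi : T -> U) (psi : U -> T),
    [/\ cancel phi psi, cancel psi phi,
        {morph phi : x y / opT x y >-> opU x y},
        continuous phi & continuous psi].

Lemma subgroup_add_subproof (V : zmodType) (G : set V) (hG : zmod_closed (mem G))
  (x y : G) : val x + val y \in G.
Proof. exact: (GRing.zmod_closed0D hG).2 _ _ (valP x) (valP y). Qed.

Definition subgroup_add (V : zmodType) (G : set V) (hG : zmod_closed (mem G))
    (x y : G) : G :=
  exist _ (val x + val y) (subgroup_add_subproof hG x y).

(* Main.v *)
Require Import Defs.
From HB Require Import structures.
From mathcomp Require Import all_boot all_order all_algebra.
From mathcomp Require Import all_classical all_reals all_analysis.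
From mathcomp Require Import ring lra zify.

Set Implicit Arguments.
Unset Strict Implicit.
Unset Printing Implicit Defensive.

Import Order.TTheory GRing.Theory Num.Theory.
Import numFieldNormedType.Exports.

Local Open Scope classical_set_scope.
Local Open Scope ring_scope.

(** The theorem says that [f] is conjugate to [x |-> - x] by a homeomorphism
    [phi] of [G] onto itself: the operation is then the addition pulled back
    along [phi] ([transport_group_structure]).

    Let [p] be the fixed point of [f] and [U = {x | x < f x}].  Then [G] is the
    disjoint union of [p], [U] and [f U], and likewise for the inversion, with
    fixed point 0 and half [U' = {x | x < - x}].  A homeomorphism between [U]
    and [U'] that tends to 0 at [p], and whose inverse tends to [p] at 0,
    extends in one way to an equivariant map, which is the wanted [phi]
    ([involutions_conjugate]).  So only a homeomorphism of halves is needed,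
    and there are three kinds of subgroups of the line.

    - The positive elements of [G] stay away from 0.  Then [G] is discrete and the two halves are both
      empty or both countably infinite, so any bijection will do.
    - [G] is the whole line.  By the intermediate value theorem [U] is the
      half-line below [p], and a translation maps it onto [U'].
    - [G] is dense and omits some point.  Points near [p] have distances to [p]
      in [G], so radii outside [G] cut [U] into nonempty clopen pieces
      shrinking to [p] ([annular_decomposition]); the same holds for [U'], and
      it remains to see that any two nonempty clopen subsets of [G] are
      homeomorphic ([clopen_homeomorphic]).

    This last fact is where sigma-compactness enters.  If [c] is not in [G], the
    multiples [k c / N!] with [0 < k <= N] are not in [G] either, so a compact
    [K] in [G] has arbitrarily many pairwise disjoint translates inside a fixed
    bounded interval, and has content zero ([compact_content0]).  On a grid with
    a small step in [G] and nodes outside [G], the cells meeting [K] are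
    therefore fewer than the cells inside a given interval.  The cells are
    clopen and are translates of each other, so a clopen neighbourhood of [K] in
    a clopen [X] can be moved, cell by cell, into any given clopen [Y] without
    exhausting it ([compact_embeds_clopen]).  Doing this back and forth along a
    countable cover of [G] by compact sets exhausts [X] and [Y] at the same
    time. *)

(** * Gluing homeomorphisms *)

(** Both maps are total, and continuous at each point of the relevant set for
    the ambient topologies.  For open sets this is the same as a homeomorphism
    of subspaces, and it spares all transport between subspace types. *)
Record homeo_between (X Y : topologicalType) (A : set X) (B : set Y)
    (h : X -> Y) (k : Y -> X) : Prop := HomeoBetween {
  homeo_sub : forall x, A x -> B (h x);
  homeo_sub' : forall y, B y -> A (k y);
  homeoK : forall x, A x -> k (h x) = x;
  homeoK' : forall y, B y -> h (k y) = y;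
  homeo_cont : forall x, A x -> {for x, continuous h};
  homeo_cont' : forall y, B y -> {for y, continuous k}
}.

Lemma homeo_between_sym (X Y : topologicalType) (A : set X) (B : set Y) h k :
  homeo_between A B h k -> homeo_between B A k h.
Proof. by case. Qed.

Lemma near_continuous_for (X Y : topologicalType) (h g : X -> Y) (A : set X) x :
  open A -> A x -> (forall y, A y -> h y = g y) ->
  {for x, continuous g} -> {for x, continuous h}.
Proof.
move=> oA Ax hg gc; rewrite /prop_for /continuous_at (hg _ Ax).
apply: cvg_trans gc; apply: near_eq_cvg.
near=> y; apply/esym/hg; near: y; exact: open_nbhs_nbhs.
Unshelve. all: by end_near. Qed.

(** Meant for disjoint [A i]; the index [i0] only serves outside their union. *)
Definition glue (I : Type) (X Y : Type) (i0 : I) (A : I -> set X)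
    (h : I -> X -> Y) (x : X) : Y :=
  h (if pselect (exists i, A i x) is left e then projT1 (cid e) else i0) x.

Lemma glueE (I : Type) (X Y : Type) (i0 : I) (A : I -> set X)
    (h : I -> X -> Y) i x : trivIset setT A -> A i x -> glue i0 A h x = h i x.
Proof.
move=> tA Aix; rewrite /glue; case: pselect => [e|]; last by case; exists i.
case: cid => j Ajx /=; congr (h _ x).
by apply: (tA j i) => //; exists x.
Qed.

(** Continuity is local, and each point has a neighbourhood, the open piece
    containing it, on which the glued map is one of the given ones. *)
Lemma homeo_bigcup (I : Type) (i0 : I) (X Y : topologicalType)
    (A : I -> set X) (B : I -> set Y) h k :
  (forall i, open (A i)) -> (forall i, open (B i)) ->
  trivIset setT A -> trivIset setT B ->
  (forall i, homeo_between (A i) (B i) (h i) (k i)) ->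
  homeo_between (\bigcup_i A i) (\bigcup_i B i) (glue i0 A h) (glue i0 B k).
Proof.
move=> oA oB tA tB H; split.
- by move=> x [i _ Ai]; exists i => //; rewrite (glueE _ _ tA Ai); apply: (homeo_sub (H i)).
- by move=> x [i _ Bi]; exists i => //; rewrite (glueE _ _ tB Bi); apply: (homeo_sub' (H i)).
- move=> x [i _ Ai]; rewrite (glueE _ _ tA Ai) (glueE _ (i := i) _ tB).
    exact: (homeoK (H i)).
  exact: (homeo_sub (H i)).
- move=> x [i _ Bi]; rewrite (glueE _ _ tB Bi) (glueE _ (i := i) _ tA).
    exact: (homeoK' (H i)).
  exact: (homeo_sub' (H i)).
- move=> x [i _ Ai]; apply: (near_continuous_for (oA i) Ai (g := h i)).
    by move=> y; apply: glueE.
  exact: (homeo_cont (H i)).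
- move=> x [i _ Bi]; apply: (near_continuous_for (oB i) Bi (g := k i)).
    by move=> y; apply: glueE.
  exact: (homeo_cont' (H i)).
Qed.

Lemma homeo_setU (X Y : topologicalType) (A A' : set X) (B B' : set Y) h k h' k' :
  open A -> open A' -> open B -> open B' ->
  A `&` A' = set0 -> B `&` B' = set0 ->
  homeo_between A B h k -> homeo_between A' B' h' k' ->
  exists h'' k'', homeo_between (A `|` A') (B `|` B') h'' k''.
Proof.
move=> oA oA' oB oB' AA' BB' H H'.
have bigcupE (Z : topologicalType) (C C' : set Z) :
    C `|` C' = \bigcup_(b : bool) (if b then C else C').
  apply/seteqP; split=> z; first by case=> Cz; [exists true|exists false].
  by case=> -[] _ Cz; [left|right].
have trivE (Z : topologicalType) (C C' : set Z) : C `&` C' = set0 ->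
    trivIset setT (fun b : bool => if b then C else C').
  move=> CC' [] [] _ _ // [z [Cz C'z]].
    by suff: (C `&` C') z by rewrite CC'.
  by suff: (C `&` C') z by rewrite CC'.
rewrite !bigcupE; do 2 eexists.
apply: (@homeo_bigcup bool true _ _ _ _ (fun b => if b then h else h') (fun b => if b then k else k')).
- by case.
- by case.
- exact: trivE.
- exact: trivE.
- by case.
Qed.

Lemma clopen_setD (X : topologicalType) (A B : set X) :
  clopen A -> clopen B -> clopen (A `\` B).
Proof.
move=> clA [oB cB]; apply: clopenI => //.
by split; [exact: closed_openC|exact: open_closedC].
Qed.

(** * Extending a homeomorphism of halves *)

(** [U] is an open fundamental domain of [f] away from its fixed point [p]. *)
Record half_of_involution (T : topologicalType) (f : T -> T) (p : T)
    (U : set T) : Prop := HalfOfInvolution {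
  half_cont : continuous f;
  halfK : involutive f;
  half_fix : f p = p;
  half_open : open U;
  half_center : ~ U p;
  half_disj : forall x, U x -> ~ U (f x);
  half_cover : forall x, x <> p -> U x \/ U (f x)
}.

Definition equivariant_extension (T : Type) (f f' : T -> T) (p' : T)
    (U : set T) (h : T -> T) (x : T) : T :=
  if x \in U then h x else if f x \in U then f' (h (f x)) else p'.

Section EquivariantExtension.
Variables (T : topologicalType) (f f' : T -> T) (p p' : T) (U U' : set T).
Variable (h : T -> T).
Hypotheses (Hf : half_of_involution f p U) (Hf' : half_of_involution f' p' U').

Local Notation phi := (equivariant_extension f f' p' U h).

Lemma equivariant_extension_half x : U x -> phi x = h x.
Proof. by move=> Ux; rewrite /equivariant_extension mem_set. Qed.

Lemma equivariant_extension_other x : U (f x) -> phi x = f' (h (f x)).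
Proof.
move=> Ufx; rewrite /equivariant_extension (mem_set Ufx) memNset //.
by move=> Ux; case: (half_disj Hf Ux).
Qed.

Lemma equivariant_extension_fix : phi p = p'.
Proof.
by rewrite /equivariant_extension (half_fix Hf) memNset //; apply: (half_center Hf).
Qed.

Lemma half_cases x : [\/ x = p, U x | U (f x)].
Proof.
have [->|/(half_cover Hf)[]] := pselect (x = p); first exact: Or31.
  exact: Or32.
exact: Or33.
Qed.

Lemma equivariant_extensionM x : phi (f x) = f' (phi x).
Proof.
case: (half_cases x) => [->|Ux|Ux].
- by rewrite (half_fix Hf) equivariant_extension_fix (half_fix Hf').
- by rewrite equivariant_extension_other (halfK Hf) // equivariant_extension_half.
- by rewrite equivariant_extension_half // equivariant_extension_other // (halfK Hf').
Qed.

(** Away from [p] the extension is locally [h] or [f' \o h \o f].  At [p] the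
    limit of [h] along [U] controls both sides, since [f] and [f'] are continuous
    and fix [p] and [p']. *)
Lemma equivariant_extension_continuous :
  (forall x, U x -> {for x, continuous h}) ->
  (forall N, nbhs p' N -> \forall x \near p, U x -> N (h x)) ->
  continuous phi.
Proof.
move=> hc hp x; case: (half_cases x) => [->|Ux|Ux].
- rewrite /continuous_at equivariant_extension_fix => N Np'.
  have Nf' : nbhs p' (f' @^-1` N).
    by apply: (half_cont Hf'); rewrite (half_fix Hf').
  have H2 : \forall x \near p, U (f x) -> N (f' (h (f x))).
    have := hp _ Nf'; rewrite -{1}(half_fix Hf); exact: (half_cont Hf).
  change (\forall y \near p, N (phi y)); near=> y.
  have Np : N p' by apply: nbhs_singleton.
  case: (half_cases y) => [->|Uy|Uy].
  + by rewrite equivariant_extension_fix.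
  + rewrite equivariant_extension_half //; move: Uy; near: y; exact: hp.
  + by rewrite equivariant_extension_other //; move: Uy; near: y.
- apply: (near_continuous_for (half_open Hf) Ux (g := h)); last exact: hc.
  exact: equivariant_extension_half.
- have ofU : open (f @^-1` U).
    by apply: open_comp (half_open Hf) => ? _; apply: (half_cont Hf).
  apply: (near_continuous_for ofU Ux (g := f' \o (h \o f))).
    exact: equivariant_extension_other.
  apply: continuous_comp; last exact: (half_cont Hf').
  apply: continuous_comp; first exact: (half_cont Hf).
  exact: hc.
Unshelve. all: by end_near. Qed.

End EquivariantExtension.

Lemma equivariant_extensionK (T : topologicalType) (f f' : T -> T) (p p' : T)
    (U U' : set T) h k :
  half_of_involution f p U -> half_of_involution f' p' U' ->
  (forall x, U x -> U' (h x)) -> (forall x, U x -> k (h x) = x) ->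
  cancel (equivariant_extension f f' p' U h) (equivariant_extension f' f p U' k).
Proof.
move=> Hf Hf' hU hK x; case: (half_cases Hf x) => [->|Ux|Ux].
- by rewrite (equivariant_extension_fix _ _ _ Hf) (equivariant_extension_fix _ _ _ Hf').
- by rewrite equivariant_extension_half // equivariant_extension_half ?hK //; apply: hU.
- rewrite (equivariant_extension_other _ _ _ Hf) // (equivariant_extension_other _ _ _ Hf') (halfK Hf').
    by rewrite hK // (halfK Hf).
  exact: hU.
Qed.

(** The two limit hypotheses are exactly what continuity of the equivariant
    extension and of its inverse needs at the fixed points. *)
Lemma involutions_conjugate (T : topologicalType) (f f' : T -> T) (p p' : T)
    (U U' : set T) h k :
  half_of_involution f p U -> half_of_involution f' p' U' ->
  homeo_between U U' h k ->
  (forall N, nbhs p' N -> \forall x \near p, U x -> N (h x)) ->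
  (forall N, nbhs p N -> \forall x \near p', U' x -> N (k x)) ->
  exists phi psi : T -> T, [/\ cancel phi psi, cancel psi phi,
    continuous phi, continuous psi & forall x, phi (f x) = f' (phi x)].
Proof.
move=> Hf Hf' [hU kU hK kK hc kc] hp kp.
exists (equivariant_extension f f' p' U h), (equivariant_extension f' f p U' k).
split.
- exact: (equivariant_extensionK Hf Hf').
- exact: (equivariant_extensionK Hf' Hf).
- exact: (equivariant_extension_continuous Hf Hf').
- exact: (equivariant_extension_continuous Hf' Hf).
- exact: (equivariant_extensionM _ Hf Hf').
Qed.

(** * Compact subsets of a proper subgroup have content zero *)

Lemma compact_norm_lt (R : realType) (K : set R) : compact K ->
  exists M : R, forall x, K x -> `|x| < M.
Proof.
move=> /compact_bounded[M0 [_ HM]]; exists (M0 + 2) => x Kx.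
have := HM (M0 + 1); rewrite ltrDl ltr01 => /(_ isT x Kx) h.
by apply: le_lt_trans h _; rewrite ltrD2l ltr1n.
Qed.

Section SubgroupOfReals.
Variables (R : realType) (G : set R) (hG : zmod_closed (mem G)).

Lemma subgroup0 : G 0.
Proof. by have [/set_mem] := hG. Qed.

Lemma subgroupB x y : G x -> G y -> G (x - y).
Proof. by move=> Gx Gy; apply/set_mem; apply: hG.2; apply: mem_set. Qed.

Lemma subgroupN x : G x -> G (- x).
Proof. by move=> Gx; rewrite -sub0r; apply: subgroupB => //; apply: subgroup0. Qed.

Lemma subgroupD x y : G x -> G y -> G (x + y).
Proof. by move=> Gx Gy; rewrite -[y]opprK; apply: subgroupB => //; apply: subgroupN. Qed.

Lemma subgroupMn x n : G x -> G (n%:R * x).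
Proof.
move=> Gx; elim: n => [|n IH]; first by rewrite mul0r; apply: subgroup0.
by rewrite -addn1 natrD mulrDl mul1r; apply: subgroupD.
Qed.

(** [N!] is a multiple of [k], so a multiple of [k c / N!] gives back [c].  This
    is why a proper subgroup of the line has infinite index, with coset
    representatives in any given neighbourhood of 0. *)
Lemma multiple_of_fraction_notin c N k : ~ G c -> (0 < k <= N)%N ->
  ~ G (k%:R * (c / N`!%:R)).
Proof.
move=> Gc kN; apply: contra_not Gc => /(subgroupMn (N`! %/ k)).
rewrite mulrA -natrM divnK ?dvdn_fact //.
by rewrite mulrC divfK // pnatr_eq0 -lt0n fact_gt0.
Qed.

(** The difference set of [K] is compact, hence closed, and lies in [G]. *)
Lemma compact_differences_avoid (K : set R) v : compact K -> K `<=` G -> ~ G v ->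
  exists2 eta : R, 0 < eta & forall a b, K a -> K b -> eta <= `|v - (a - b)|.
Proof.
move=> cK KG Gv; pose D := (fun z : R * R => z.1 - z.2) @` (K `*` K).
have cD : compact D.
  apply: continuous_compact; last exact: compact_setX.
  apply: continuous_subspaceT => z; apply: continuousB; [exact: cvg_fst|exact: cvg_snd].
have Dv : ~ D v by case=> [[a b]] /= [Ka Kb] E; apply: Gv; rewrite -E; apply: subgroupB; apply: KG.
have : nbhs v (~` D).
  apply: open_nbhs_nbhs; split => //; apply: closed_openC.
  exact: compact_closed (@Rhausdorff _) cD.
move/nbhs_ballP => [eta /= e0 He]; exists eta => // a b Ka Kb.
rewrite leNgt; apply/negP => lt; apply: (He _ lt).
by exists (a, b).
Qed.

(** The differences of the [N] shifts are nonzero multiples of [c / N!], which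
    avoid the difference set of [K] by a uniform amount. *)
Lemma separated_shifts (K : set R) c N : compact K -> K `<=` G -> ~ G c ->
  exists2 eta : R, 0 < eta & forall i j a b, (i < N)%N -> (j < N)%N -> i <> j ->
    K a -> K b -> eta <= `|(a + i%:R * (c / N`!%:R)) - (b + j%:R * (c / N`!%:R))|.
Proof.
move=> cK KG Gc; set e := c / _.
have [eta e0 He] : exists2 eta : R, 0 < eta & forall k a b, (0 < k <= N)%N ->
    K a -> K b -> eta <= `|k%:R * e - (a - b)|.
  suff: forall n, (n <= N)%N -> exists2 eta : R, 0 < eta & forall k a b,
      (0 < k <= n)%N -> K a -> K b -> eta <= `|k%:R * e - (a - b)|.
    exact.
  elim=> [|n IH] nN.
    by exists 1 => // k a b; case: k.
  have [eta1 h1 H1] := IH (ltnW nN).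
  have kn : (0 < n.+1 <= N)%N by [].
  have [eta2 h2 H2] := compact_differences_avoid cK KG (multiple_of_fraction_notin Gc kn).
  exists (Num.min eta1 eta2); first by rewrite lt_min h1.
  move=> k a b /andP[k0 kn1] Ka Kb; rewrite ge_min.
  move: kn1; rewrite leq_eqVlt => /orP[/eqP->|kn1]; first by rewrite H2 ?orbT.
  by rewrite H1 // k0.
exists eta => // i j a b iN jN ij Ka Kb.
have [ji|ji] : (j < i)%N \/ (i < j)%N by lia.
  have -> : a + i%:R * e - (b + j%:R * e) = (i - j)%:R * e - (b - a).
    by rewrite natrB ?(ltnW ji) //; ring.
  by apply: He => //; lia.
have -> : a + i%:R * e - (b + j%:R * e) = - ((j - i)%:R * e - (a - b)).
  by rewrite natrB ?(ltnW ji) //; ring.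
by rewrite normrN; apply: He => //; lia.
Qed.

(** The translates of [K] by the [N] multiples of [c / N!] stay in an interval
    of length [L] that does not depend on [N], and they are [eta]-separated.  Take
    one point of [K] in each cell of [J].  On a grid of step less than [eta],
    shifted points in a common cell come from the same translate, and then at
    most two of them share that cell.  So [N] times the number of cells in [J] is at most
    twice the total number of cells, about [2 L / delta]. *)
Lemma compact_content0 (K : set R) c t (eps : R) : compact K -> K `<=` G -> ~ G c ->
  K `<=` [set x | t < x] -> 0 < eps ->
  exists2 delta0 : R, 0 < delta0 & forall (delta : R) (J : seq nat), 0 < delta < delta0 ->
    uniq J ->
    (forall j, j \in J -> exists2 x, K x & t + j%:R * delta < x < t + j.+1%:R * delta) ->
    (size J)%:R * delta < eps.
Proof.
move=> cK KG; wlog c0 : c / 0 < c => [H Gc|Gc tK eps0].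
  have [c0|c0|c0] := ltgtP 0 c; first exact: H c0 Gc.
    apply: (H (- c)); first by rewrite oppr_gt0.
    by apply: contra_not Gc => /subgroupN; rewrite opprK.
  by case: Gc; rewrite -c0; apply: subgroup0.
have [M HM] := compact_norm_lt cK.
pose L := `|M + c - t|.
have L0 : 0 <= L by exact: normr_ge0.
(* [4 L] leaves room for the factor 2 and for the rounding of [L / delta]. *)
have [N HN] : exists N, 4 * L < N.+1%:R * eps.
  exists (Num.trunc (4 * L / eps)); rewrite -ltr_pdivrMr //.
  have /Num.Theory.truncn_itv/andP[_] // : 0 <= 4 * L / eps.
  by rewrite divr_ge0 ?mulr_ge0 ?ler0n // ltW.
have [eta eta0 Heta] := separated_shifts N.+1 cK KG Gc.
pose sigma := N.+1%:R * eps - 4 * L.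
exists (Num.min eta (sigma / 4)).
  by rewrite lt_min eta0 /= divr_gt0 // subr_gt0.
move=> delta J /andP[d0]; rewrite lt_min => /andP[deta dsigma] uJ HJ.
set e := c / _ in Heta.
have e0 : 0 < e by rewrite divr_gt0 // ltr0n fact_gt0.
have Ne i : (i < N.+1)%N -> i%:R * e <= c.
  move=> iN; apply: (@le_trans _ _ (N.+1`!%:R * e)).
    apply: ler_wpM2r; first exact: ltW.
    rewrite ler_nat; exact: leq_trans (ltnW iN) (fact_geq N.+1).
  by rewrite /e mulrC divfK // pnatr_eq0 -lt0n fact_gt0.
have /choice[kf Hkf] : forall j, exists x, j \in J ->
    K x /\ t + j%:R * delta < x < t + j.+1%:R * delta.
  move=> j; have [/HJ[x Kx xj]|] := boolP (j \in J); first by exists x.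
  by exists 0.
have [P HP LP] : exists2 P, P%:R * delta <= L + delta & L < P%:R * delta.
  have /Num.Theory.truncn_itv/andP[h1 h2] : 0 <= L / delta by rewrite divr_ge0 // ltW.
  exists (Num.trunc (L / delta)).+1; last by rewrite -ltr_pdivrMr.
  by rewrite -addn1 natrD mulrDl mul1r lerD2r -ler_pdivlMr.
pose cellof j i := Num.trunc ((kf j + i%:R * e - t) / delta).
have Hcell j i : j \in J -> (i < N.+1)%N ->
    (cellof j i)%:R * delta <= kf j + i%:R * e - t < (cellof j i).+1%:R * delta.
  move=> /Hkf[Kj _] iN; rewrite -ler_pdivlMr // -ltr_pdivrMr //.
  apply: Num.Theory.truncn_itv; rewrite divr_ge0 ?ltW //.
  rewrite subr_gt0; apply: ltr_wpDr; first by rewrite mulr_ge0 // ltW.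
  exact: tK.
have HcellP j i : j \in J -> (i < N.+1)%N -> (cellof j i < P)%N.
  move=> jJ iN; have /andP[h _] := Hcell _ _ jJ iN; have [Kj _] := Hkf _ jJ.
  have KM := le_lt_trans (ler_norm _) (HM _ Kj); have ic := Ne _ iN.
  rewrite -(ltr_nat R) -(ltr_pM2r d0); apply: le_lt_trans LP.
  apply: le_trans h _; apply: le_trans (ler_norm _); rewrite lerD2r.
  by rewrite lerD // ltW.
have succM n : n.+1%:R * delta = n%:R * delta + delta by rewrite -natr1 mulrDl mul1r.
have order j j' i : j \in J -> j' \in J -> (i < N.+1)%N -> odd j = odd j' ->
    cellof j i = cellof j' i -> ~ (j < j')%N.
  move=> jJ j'J iN oj E jj'.
  have jj2 : (j.+2 <= j')%N by move: oj jj'; clear; lia.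
  have /andP[_ h1] := (Hkf _ jJ).2; have /andP[h2 _] := (Hkf _ j'J).2.
  have := Hcell _ _ jJ iN; have := Hcell _ _ j'J iN; rewrite -E !succM.
  have : j.+2%:R * delta <= j'%:R * delta by apply: ler_wpM2r; [exact: ltW|rewrite ler_nat].
  rewrite !succM; rewrite succM in h1.
  by move=> h3 /andP[h4 h5] /andP[h6 h7]; lra.
(* Two points in the same cell can only come from adjacent indices, which the
   parity of the index tells apart. *)
pose F (x : nat * nat) := (cellof x.1 x.2, odd x.1).
pose S := [seq (j, i) | j <- J, i <- iota 0 N.+1].
have FS : {in S &, injective F}.
  move=> x y /allpairsP[[j i] [jJ iN ->]] /allpairsP[[j' i'] [jJ' iN' ->]].
  rewrite !mem_iota /= !add0n in iN iN'; rewrite /= in jJ jJ'.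
  rewrite /F /= => -[E oj].
  have ii : i = i'.
    apply/eqP/negPn/negP => /eqP ii.
    have := Heta _ _ _ _ iN iN' ii (Hkf _ jJ).1 (Hkf _ jJ').1.
    have := Hcell _ _ jJ iN; have := Hcell _ _ jJ' iN'; rewrite -E !succM.
    move=> /andP[h4 h5] /andP[h6 h7]; apply/negP; rewrite -ltNge.
    by apply: lt_trans deta; rewrite ltr_norml; apply/andP; split; lra.
  subst i'; congr pair.
  have [||//] := ltngtP j j'; first by move/(order _ _ _ jJ jJ' iN oj E).
  by move/(order _ _ _ jJ' jJ iN (esym oj) (esym E)).
have : (size J * N.+1 <= P * 2)%N.
  rewrite -{1}(size_iota 0 N.+1) -(size_allpairs pair) -/S -(size_map F).
  rewrite -{1}(size_iota 0 P) -(size_allpairs pair _ [:: true; false]).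
  apply: uniq_leq_size.
    rewrite map_inj_in_uniq //; apply: allpairs_uniq => //; first exact: iota_uniq.
    by move=> [? ?] [? ?].
  move=> _ /mapP[_ /allpairsP[[j i] [jJ iN ->]] ->].
  rewrite mem_iota /= add0n in iN; rewrite /= in jJ.
  apply/allpairsP; exists (F (j, i)); split => //=.
    by rewrite mem_iota add0n; apply: HcellP.
  by rewrite !inE; case: odd.
rewrite -(ler_nat R) !natrM -(ler_pM2r d0) => H.
have N0 : 0 < N.+1%:R :> R by rewrite ltr0n.
rewrite -(ltr_pM2l N0).
have -> : N.+1%:R * ((size J)%:R * delta) = (size J)%:R * N.+1%:R * delta by ring.
apply: le_lt_trans H _.
have -> : P%:R * 2%:R * delta = 2 * (P%:R * delta) by ring.
rewrite /sigma in dsigma.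
lra.
Qed.
End SubgroupOfReals.

(** * Translations and grids *)

Section Translations.
Variables (R : realType) (G : set R) (hG : zmod_closed (mem G)).
Local Notation T := (set_type G).

Lemma val_subgroup (x : T) : G (val x).
Proof. exact/set_mem/(valP x). Qed.

Lemma val_continuous : continuous (val : T -> R).
Proof. exact: initial_continuous. Qed.

Lemma continuous_into_subgroup (X : topologicalType) (h : X -> T) :
  continuous (val \o h) -> continuous h.
Proof. exact: continuous_comp_initial. Qed.

Lemma nbhs_subgroupP (x : T) (N : set T) :
  nbhs x N <-> exists2 eps : R, 0 < eps & forall y : T, `|val x - val y| < eps -> N y.
Proof. by split=> [/nbhs_ballP[e /= e0 He]|[e e0 He]]; [|apply/nbhs_ballP]; exists e. Qed.

Lemma open_val_lt c : open [set x : T | val x < c].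
Proof. exact: (continuousP _).1 val_continuous _ (@open_lt R c). Qed.

Lemma open_val_gt c : open [set x : T | c < val x].
Proof. exact: (continuousP _).1 val_continuous _ (@open_gt R c). Qed.

Definition translation (s : R) (Gs : G s) (x : T) : T :=
  SigSub (mem_set (subgroupD hG (val_subgroup x) Gs)).

Lemma translation_continuous s (Gs : G s) : continuous (translation Gs).
Proof.
apply: continuous_into_subgroup => x.
apply: (@continuousD _ _ _ (val : T -> R) (cst s)); [exact: val_continuous|exact: cst_continuous].
Qed.

Lemma translationK s (Gs : G s) (Gs' : G (- s)) : cancel (translation Gs) (translation Gs').
Proof. by move=> x; apply: val_inj; rewrite /= addrK. Qed.

Lemma homeo_translation s (Gs : G s) (Gs' : G (- s)) A :
  homeo_between A (translation Gs' @^-1` A) (translation Gs) (translation Gs').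
Proof.
have K : cancel (translation Gs') (translation Gs).
  by move=> x; apply: val_inj; rewrite /= addrNK.
split=> //.
- by move=> x Ax; rewrite /= translationK.
- by move=> x _; apply: translationK.
- by move=> x _; apply: translation_continuous.
- by move=> x _; apply: translation_continuous.
Qed.

(** When the nodes lie outside [G], these open cells cover the part of [G] above
    [t]. *)
Definition cell (t delta : R) (j : nat) : set T :=
  [set x | t + j%:R * delta < val x < t + j.+1%:R * delta].

Lemma cell_inj t delta j j' x : 0 < delta ->
  cell t delta j x -> cell t delta j' x -> j = j'.
Proof.
move=> d0; wlog jj : j j' / (j < j')%N => [H cj cj'|/andP[_ h1] /andP[h2 _]].
  by have [/H|/H/(_ cj' cj)|] := ltngtP j j' => // ->.
have := lt_trans h2 h1; rewrite ltrD2l ltr_pM2r // ltr_nat ltnNge.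
by rewrite jj.
Qed.

Hypothesis dense : forall a b : R, a < b -> exists2 g, G g & a < g < b.

Section Grid.
Variables (t delta : R).
Hypotheses (Gt : ~ G t) (Gdelta : G delta) (delta0 : 0 < delta).

Lemma grid_notin j : ~ G (t + j%:R * delta).
Proof.
apply: contra_not Gt => Gj; rewrite -[t](addrK (j%:R * delta)).
by apply: subgroupB => //; apply: subgroupMn.
Qed.

Lemma cell_cover x : t < val x -> exists j, cell t delta j x.
Proof.
move=> tx; have /Num.Theory.truncn_itv : 0 <= (val x - t) / delta.
  by rewrite divr_ge0 ?subr_ge0 // ltW.
set j := Num.trunc _; rewrite ler_pdivlMr // ltr_pdivrMr // => /andP[h1 h2].
exists j; apply/andP; split; last by rewrite -ltrBlDl.
rewrite lt_neqAle -lerBrDl h1 andbT; apply/eqP => E.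
by apply: (@grid_notin j); rewrite E; apply: val_subgroup.
Qed.

Lemma clopen_cell j : clopen (cell t delta j).
Proof.
split.
  have -> : cell t delta j = [set x | t + j%:R * delta < val x] `&`
      [set x | val x < t + j.+1%:R * delta].
    by apply/seteqP; split=> x /andP.
  apply: openI; [exact: open_val_gt|exact: open_val_lt].
rewrite -openC.
have -> : ~` cell t delta j = [set x | val x < t + j%:R * delta] `|`
      [set x | t + j.+1%:R * delta < val x].
  apply/seteqP; split=> x.
    move/negP; rewrite negb_and -!leNgt !le_eqVlt => /orP[]/orP[/eqP E|]; try by [left|right].
      by case: (@grid_notin j); rewrite -E; apply: val_subgroup.
    by case: (@grid_notin j.+1); rewrite E; apply: val_subgroup.
  by move=> [] /= h; apply/negP; rewrite negb_and -!leNgt (ltW h) ?orbT.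
apply: openU; [exact: open_val_lt|exact: open_val_gt].
Qed.

Lemma cell_nonempty j : cell t delta j !=set0.
Proof.
have [|g Gg gP] := @dense (t + j%:R * delta) (t + j.+1%:R * delta).
  by rewrite ltrD2l ltr_pM2r // ltr_nat.
by exists (SigSub (mem_set Gg)).
Qed.

(** One of the [n + 2] steps that fit in the interval is lost at its left end,
    where [a] is rounded up to a node. *)
Lemma cells_in_interval (a l : R) (n : nat) : t <= a -> (n.+2)%:R * delta <= l ->
  exists j0, forall i, (i < n.+1)%N -> cell t delta (j0 + i) `<=` [set x | a < val x < a + l].
Proof.
move=> ta nl; have /Num.Theory.truncn_itv : 0 <= (a - t) / delta.
  by rewrite divr_ge0 ?subr_ge0 // ltW.
set j := Num.trunc _; rewrite ler_pdivlMr // ltr_pdivrMr // => /andP[h1 h2].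
exists j.+1 => i iN x /andP[g1 g2] /=.
have g3 : (j.+1 + i).+1%:R * delta <= j%:R * delta + n.+2%:R * delta.
  by rewrite -mulrDl -natrD ler_pM2r // ler_nat; lia.
have g4 : j.+1%:R * delta <= (j.+1 + i)%:R * delta.
  by rewrite ler_pM2r // ler_nat; lia.
apply/andP; split.
  by apply: lt_trans g1; rewrite -ltrBlDl; apply: lt_le_trans h2 g4.
apply: lt_le_trans g2 _; apply: le_trans (_ : t + (j%:R * delta + l) <= _).
  by rewrite lerD2l; apply: le_trans g3 _; rewrite lerD2l.
by rewrite addrA lerD2r -lerBrDl.
Qed.

End Grid.
End Translations.

(** * Moving a compact set into a clopen set *)

Section DenseProper.
Variables (R : realType) (G : set R) (hG : zmod_closed (mem G)).
Hypothesis dense : forall a b : R, a < b -> exists2 g, G g & a < g < b.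
Variable c : R.
Hypothesis Gc : ~ G c.
Local Notation T := (set_type G).

(** Choose a grid so fine that the cells meeting [K] are fewer than those of an
    interval inside [X] and of one inside [Y].  The part of [X] in the cells
    meeting [K] is then moved into [Y] by one translation per cell.  Some cell of
    [X] does not meet [K] and some cell of [Y] is not used, hence the nonempty
    remainders, which allow the construction to be iterated. *)
Lemma compact_embeds_clopen (K : set R) (X Y : set T) : compact K -> K `<=` G ->
  clopen X -> clopen Y -> X !=set0 -> Y !=set0 ->
  exists (A B : set T) (h k : T -> T),
    [/\ [/\ clopen A, A `<=` X & X `\` A !=set0],
        [/\ clopen B, B `<=` Y & Y `\` B !=set0],
        (forall x, X x -> K (val x) -> A x) & homeo_between A B h k].
Proof.
move=> cK KG clX clY [x Xx] [y Yy].
have [ell l0 [HX HY]] : exists2 l : R, 0 < l &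
    [set z : T | val x < val z < val x + l] `<=` X /\
    [set z : T | val y < val z < val y + l] `<=` Y.
  have /nbhs_subgroupP[e1 e10 H1] : nbhs x X by apply: open_nbhs_nbhs; split=> //; case: clX.
  have /nbhs_subgroupP[e2 e20 H2] : nbhs y Y by apply: open_nbhs_nbhs; split=> //; case: clY.
  exists (Num.min e1 e2); first by rewrite lt_min e10.
  have aux (a b l : R) : a < b < a + l -> `|a - b| < l.
    by move=> /andP[h1 h2]; rewrite ltr_norml; apply/andP; split; lra.
  split=> z /= /aux; rewrite lt_min => /andP[h1 h2]; first exact: H1.
  exact: H2.
have [M HM] := compact_norm_lt cK.
have [t Gt [tM [tx ty]]] : exists2 t, ~ G t & t < - M /\ t < val x /\ t < val y.
  pose b := Num.min (- M) (Num.min (val x) (val y)).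
  have [|g Gg /andP[g1 _]] := @dense (c - b) (c - b + 1); first by rewrite ltrDl.
  exists (c - g).
    apply: contra_not Gc => /(subgroupD hG)/(_ Gg).
    by rewrite addrNK.
  have : c - g < b by lra.
  by rewrite !lt_min => /andP[-> /andP[-> ->]].
have tK : K `<=` [set z | t < z].
  move=> z /HM; rewrite ltr_norml => /andP[h _]; exact: lt_trans tM h.
(* Half of [ell] bounds the cells meeting [K]; the other half has room for one
   more cell and for the rounding of the end of the interval to a node. *)
have ell2 : 0 < ell / 2 by rewrite divr_gt0.
have [d0 d00 Hd0] := compact_content0 hG cK KG Gc tK ell2.
have [delta Gdelta /andP[delta0]] : exists2 d : R, G d & 0 < d < Num.min d0 (ell / 4).
  by apply: dense; rewrite lt_min d00 divr_gt0.
rewrite lt_min => /andP[dd0 dl4].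
pose P := (Num.trunc ((M - t) / delta)).+1.
pose J := [seq j <- iota 0 P | `[< exists2 z : T, K (val z) & cell t delta j z >]].
have HJ (z : T) j : K (val z) -> cell t delta j z -> j \in J.
  move=> Kz cz; rewrite mem_filter; apply/andP; split; first by apply/asboolP; exists z.
  rewrite mem_iota add0n /= /P.
  have [z0 zM] : t < val z /\ val z < M.
    by split; [exact: tK|exact: le_lt_trans (ler_norm _) (HM _ Kz)].
  have /Num.Theory.truncn_itv/andP[_] : 0 <= (M - t) / delta.
    by rewrite divr_ge0 ?subr_ge0 // ltW //; apply: lt_trans z0 zM.
  rewrite ltr_pdivrMr // => h.
  have /andP[cz1 _] := cz.
  rewrite -(ltr_nat R) -(ltr_pM2r delta0); apply: lt_trans h.
  by rewrite ltrBrDl; apply: lt_trans zM.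
have uJ : uniq J by rewrite filter_uniq // iota_uniq.
have : (size J)%:R * delta < ell / 2.
  apply: Hd0 => //; first by rewrite delta0.
  move=> j; rewrite mem_filter => /andP[/asboolP[z Kz cz] _].
  by exists (val z).
clearbody J; set n := size J => nJ.
have nl : n.+2%:R * delta <= ell.
  by rewrite -addn2 natrD mulrDl; lra.
have [jx Hjx] := cells_in_interval G delta0 (ltW tx) nl.
have [jy Hjy] := cells_in_interval G delta0 (ltW ty) nl.
pose cl j := clopen_cell hG Gt Gdelta j.
(* The [i]-th cell meeting [K] goes to the [i]-th cell of the block in [Y]. *)
pose s i := (jy + i)%:R * delta - (nth 0%N J i)%:R * delta.
have Gs i : G (s i) by apply: subgroupB => //; apply: subgroupMn.
have Gs' i : G (- s i) by apply: subgroupN.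
pose A_ i := [set z | (i < n)%N /\ (X z /\ cell t delta (nth 0%N J i) z)].
pose B_ i := translation hG (Gs' i) @^-1` A_ i.
have clA i : clopen (A_ i).
  have [iN|iN] := boolP (i < n)%N; last first.
    rewrite (_ : A_ i = set0); first by split; [exact: open0|exact: closed0].
    by apply/seteqP; split=> z // -[h _]; rewrite h in iN.
  rewrite (_ : A_ i = X `&` cell t delta (nth 0%N J i)); first exact: clopenI.
  by apply/seteqP; split=> z // [].
have clB i : clopen (B_ i).
  by apply: preimage_clopen (clA i) _; apply: translation_continuous.
have Bcell i z : B_ i z -> cell t delta (jy + i) z.
  move=> [_ [_]]; rewrite /cell /= => /andP[h1 h2].
  have e m : m.+1%:R * delta = m%:R * delta + delta by rewrite -natr1 mulrDl mul1r.
  rewrite !e in h2 *; rewrite /s in h1 h2.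
  by apply/andP; split; lra.
have clbig (F : nat -> set T) : (forall i, clopen (F i)) -> (forall i z, F i z -> (i < n)%N) ->
    clopen (\bigcup_i F i).
  move=> clF Fn; split; first by apply: bigcup_open => i _; case: (clF i).
  rewrite (_ : \bigcup_i F i = \bigcup_(i in `I_n) F i).
    by apply: closed_bigcup => // i _; case: (clF i).
  by apply/seteqP; split=> z [i _ Fi]; exists i => //=; apply: Fn Fi.
exists (\bigcup_i A_ i), (\bigcup_i B_ i).
eexists _, _; split.
- split.
  + by apply: clbig => // i z [].
  + by move=> z [i _ [_ []]].
  + have /hasP[j jI jJ] : has (fun j => j \notin J) [seq (jx + i)%N | i <- iota 0 n.+1].
      rewrite -[has _ _]negbK -all_predC; apply/negP => /allP H.
      have : (size [seq (jx + i)%N | i <- iota 0 n.+1] <= n)%N.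
        apply: uniq_leq_size; first by rewrite map_inj_uniq ?iota_uniq //; apply: addnI.
        by move=> j /H /=; rewrite negbK.
      by rewrite size_map size_iota ltnn.
    move: jI => /mapP[i]; rewrite mem_iota add0n => /andP[_ iN] ji.
    have [z cz] := cell_nonempty dense t delta0 j.
    exists z; split; first by apply: HX; apply: (Hjx i) => //; rewrite -ji.
    move=> [i' _ [iN' [_ ci']]]; move: jJ; rewrite (cell_inj delta0 cz ci').
    by rewrite mem_nth.
- split.
  + by apply: clbig => // i z [].
  + move=> z [i _ Bz]; apply: HY; apply: (Hjy i); last exact: Bcell.
    by case: Bz => iN _; apply: ltnW.
  + have [z cz] := cell_nonempty dense t delta0 (jy + n).
    exists z; split; first by apply: HY; apply: (Hjy n).
    move=> [i _ Bz]; have := cell_inj delta0 cz (Bcell _ _ Bz).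
    by case: Bz => iN _ /addnI E; rewrite -E ltnn in iN.
- move=> z Xz Kz; have [j cj] := cell_cover hG Gt Gdelta delta0 (tK _ Kz).
  have jJ := HJ _ _ Kz cj.
  by exists (index j J) => //; rewrite /A_ /= index_mem jJ nth_index.
- apply: (homeo_bigcup 0%N).
  + by move=> i; case: (clA i).
  + by move=> i; case: (clB i).
  + move=> i i' _ _ [z [[iN [_ ci]] [iN' [_ ci']]]].
    by apply/eqP; rewrite -(nth_uniq 0%N iN iN' uJ); apply/eqP; apply: cell_inj delta0 ci ci'.
  + move=> i i' _ _ [z [/Bcell ci /Bcell ci']].
    exact: addnI (cell_inj delta0 ci ci').
  + by move=> i; apply: (homeo_translation hG (Gs i)).
Qed.
End DenseProper.

(** * Nonempty clopen subsets are homeomorphic *)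

Section BackAndForth.
Variables (R : realType) (G : set R) (hG : zmod_closed (mem G)).
Hypothesis dense : forall a b : R, a < b -> exists2 g, G g & a < g < b.
Variable c : R.
Hypothesis Gc : ~ G c.
Local Notation T := (set_type G).

(** One step forth and, on what remains, one step back. *)
Lemma compact_matched_clopen (K : set R) (X Y : set T) : compact K -> K `<=` G ->
  clopen X -> clopen Y -> X !=set0 -> Y !=set0 ->
  exists (A B : set T) (h k : T -> T),
    [/\ [/\ clopen A, A `<=` X & X `\` A !=set0],
        [/\ clopen B, B `<=` Y & Y `\` B !=set0],
        (forall x, X x -> K (val x) -> A x),
        (forall y, Y y -> K (val y) -> B y) & homeo_between A B h k].
Proof.
move=> cK KG clX clY X0 Y0.
have [A1 [B1 [h1 [k1 [[clA1 A1X XA1] [clB1 B1Y YB1] KA1 H1]]]]] :=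
  compact_embeds_clopen hG dense Gc cK KG clX clY X0 Y0.
have [B2 [A2 [k2 [h2 [[clB2 B2Y YB2] [clA2 A2X XA2] KB2 /homeo_between_sym H2]]]]] :=
  compact_embeds_clopen hG dense Gc cK KG (clopen_setD clY clB1) (clopen_setD clX clA1) YB1 XA1.
have [||||||h [k H]] := homeo_setU _ _ _ _ _ _ H1 H2.
- by case: clA1.
- by case: clA2.
- by case: clB1.
- by case: clB2.
- by apply/seteqP; split=> z // [A1z /A2X[]].
- by apply/seteqP; split=> z // [B1z /B2Y[]].
exists (A1 `|` A2), (B1 `|` B2), h, k; split => //.
- split; first exact: clopenU.
    by move=> z [/A1X|/A2X[]].
  by rewrite -setDDl.
- split; first exact: clopenU.
    by move=> z [/B1Y|/B2Y[]].
  by rewrite -setDDl.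
- by move=> z Xz Kz; left; apply: KA1.
- move=> z Yz Kz; have [B1z|B1z] := pselect (B1 z); [by left|right].
  exact: KB2.
Qed.

Hypothesis G_sigma_compact : sigma_compact G.

(** Stage [n] treats the [n]-th compact set on both sides of what is left, so
    that the matched pieces exhaust [U] and [V]. *)
Lemma clopen_homeomorphic (U V : set T) : clopen U -> clopen V ->
  U !=set0 -> V !=set0 -> exists h k, homeo_between U V h k.
Proof.
move=> clU clV U0 V0; have [K [cK GK]] := G_sigma_compact.
have KG n : K n `<=` G by rewrite GK => x Kx; exists n.
pose good (X : set T) := clopen X /\ X !=set0.
have /choice[F HF] : forall nXY : nat * (set T * set T), exists q : (set T * set T) * ((T -> T) * (T -> T)),
    good nXY.2.1 -> good nXY.2.2 ->
    [/\ [/\ clopen q.1.1, q.1.1 `<=` nXY.2.1 & nXY.2.1 `\` q.1.1 !=set0],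
        [/\ clopen q.1.2, q.1.2 `<=` nXY.2.2 & nXY.2.2 `\` q.1.2 !=set0],
        (forall x, nXY.2.1 x -> K nXY.1 (val x) -> q.1.1 x),
        (forall y, nXY.2.2 y -> K nXY.1 (val y) -> q.1.2 y) &
        homeo_between q.1.1 q.1.2 q.2.1 q.2.2].
  move=> [n [X Y]] /=.
  have [[clX X0]|] := pselect (good X); last by exists (set0, set0, (id, id)).
  have [[clY Y0]|] := pselect (good Y); last by exists (set0, set0, (id, id)).
  have [A [B [h [k H]]]] := compact_matched_clopen (cK n) (KG n) clX clY X0 Y0.
  by exists (A, B, (h, k)).
pose fix rest n : set T * set T := if n is m.+1 then
  let q := F (m, rest m) in ((rest m).1 `\` q.1.1, (rest m).2 `\` q.1.2) else (U, V).
pose A n := (F (n, rest n)).1.1; pose B n := (F (n, rest n)).1.2.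
have goodr n : good (rest n).1 /\ good (rest n).2.
  elim: n => [|n [IH1 IH2]]; first by [].
  have [[clA _ A0] [clB _ B0] _ _ _] := HF (n, rest n) IH1 IH2.
  by split; split => //=; apply: clopen_setD => //; [case: IH1|case: IH2].
have HF' n := HF (n, rest n) (goodr n).1 (goodr n).2.
(* A point of the [n]-th compact set is used up at stage [n] at the latest. *)
have cover (C rC : nat -> set T) : (forall n, rC n.+1 = rC n `\` C n) ->
    (forall n x, rC n x -> K n (val x) -> C n x) ->
    (forall n, C n `<=` rC n) -> rC 0%N = \bigcup_n C n.
  move=> rS KC Cr; apply/seteqP; split=> x.
    have Kcover y : G y -> exists n, K n y by rewrite GK => -[n _ Kny]; exists n.
    move=> Cx; have [n Knx] := Kcover _ (val_subgroup x).
    have [rn|rn] := pselect (rC n x); first by exists n => //; apply: KC.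
    elim: n rn {Knx} => [//|n IH]; rewrite rS => rn.
    have [/IH//|rn'] := pselect (~ rC n x).
    by exists n => //; apply: contrapT => Cn; apply: rn; split => //; apply: contrapT.
  have sub n : rC n `<=` rC 0%N.
    by elim: n => // n IH y; rewrite rS => -[/IH].
  by move=> [n _ /Cr/sub].
have triv (C rC : nat -> set T) : (forall n, rC n.+1 = rC n `\` C n) ->
    (forall n, C n `<=` rC n) -> trivIset setT C.
  move=> rS Cr; have sub n m : (n < m)%N -> rC m `<=` rC n `\` C n.
    elim: m => // m IH; rewrite ltnS leq_eqVlt => /orP[/eqP->|/IH h]; first by rewrite rS.
    by rewrite rS => x [/h].
  move=> i j _ _ [x [Ci Cj]]; have [ij|ji|//] := ltngtP i j.
    by have [] := sub _ _ ij x (Cr _ _ Cj).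
  by have [] := sub _ _ ji x (Cr _ _ Ci).
have UA : U = \bigcup_n A n.
  apply: (cover A (fst \o rest)) => // n; have [[_ s _] _ KC _ _] := HF' n; [exact: KC|exact: s].
have VB : V = \bigcup_n B n.
  apply: (cover B (snd \o rest)) => // n; have [_ [_ s _] _ KC _] := HF' n; [exact: KC|exact: s].
rewrite UA VB; do 2 eexists; apply: (homeo_bigcup 0%N).
- by move=> n; have [[[]]] := HF' n.
- by move=> n; have [_ [[]]] := HF' n.
- by apply: (triv A (fst \o rest)) => // n; have [[_ s _] _ _ _ _] := HF' n; exact: s.
- by apply: (triv B (snd \o rest)) => // n; have [_ [_ s _] _ _ _] := HF' n; exact: s.
- by move=> n; have [_ _ _ _ H] := HF' n; exact: H.
Qed.
End BackAndForth.

(** * Dense proper subgroups *)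

Section Involutions.
Variables (R : realType) (G : set R) (hG : zmod_closed (mem G)).
Local Notation T := (set_type G).

Definition moved_up (f : T -> T) : set T := [set x | val x < val (f x)].

Lemma open_val_lt2 (g h : T -> T) : continuous g -> continuous h ->
  open [set x | val (g x) < val (h x)].
Proof.
move=> cg ch.
rewrite (_ : mkset _ = (fun x => val (h x) - val (g x)) @^-1` [set r : R | 0 < r]).
  apply: (continuousP _).1 _ _ (@open_gt R 0) => x.
  apply: (@continuousB _ _ _ (val \o h) (val \o g)).
    by apply: continuous_comp; [exact: ch|exact: val_continuous].
  by apply: continuous_comp; [exact: cg|exact: val_continuous].
by apply/seteqP; split=> x /=; rewrite subr_gt0.
Qed.

(** A point other than [p] is moved, and [f] exchanges the points moved up with
    those moved down. *)
Lemma half_moved_up f p : continuous f -> involutive f ->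
  unique (fun x => f x = x) p -> half_of_involution f p (moved_up f).
Proof.
move=> fc ff [fp pu]; split=> //.
- by apply: open_val_lt2 => //; move=> x; apply: cvg_id.
- by rewrite /moved_up /= fp ltxx.
- by move=> x /= h1 h2; move: (lt_trans h1 h2); rewrite ff ltxx.
- move=> x xp; rewrite /moved_up /= ff.
  have [h|h|h] := ltgtP (val x) (val (f x)); [by left|by right|].
  by case: xp; apply/esym/pu/val_inj.
Qed.

Definition subgroup_opp (x : T) : T := SigSub (mem_set (subgroupN hG (val_subgroup x))).
Definition subgroup_zero : T := SigSub (mem_set (subgroup0 hG)).

Lemma subgroup_oppK : involutive subgroup_opp.
Proof. by move=> x; apply: val_inj; rewrite /= opprK. Qed.

Lemma subgroup_opp_continuous : continuous subgroup_opp.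
Proof.
apply: continuous_into_subgroup => x.
by apply: (@continuousN _ _ _ (val : T -> R)); apply: val_continuous.
Qed.

Lemma subgroup_opp_fixed : unique (fun x => subgroup_opp x = x) subgroup_zero.
Proof.
split; first by apply: val_inj; rewrite /= oppr0.
by move=> x /(congr1 val) /= h; apply: val_inj => /=; lra.
Qed.

End Involutions.

Section AnnularDecomposition.
Variables (R : realType) (G : set R) (hG : zmod_closed (mem G)).
Hypothesis dense : forall a b : R, a < b -> exists2 g, G g & a < g < b.
Variable c : R.
Hypothesis Gc : ~ G c.
Local Notation T := (set_type G).
Variables (f : T -> T) (p : T).
Hypotheses (fc : continuous f) (ff : involutive f) (fp : unique (fun x => f x = x) p).

Local Notation d := (fun x : T => `|val x - val p|).

Lemma distance_subgroup x : G (d x).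
Proof.
have h : G (val x - val p) by apply: subgroupB => //; apply: val_subgroup.
by rewrite /=; have [_|_] := ger0P (val x - val p); [|apply: (subgroupN hG)].
Qed.

Lemma distance_gt0 x : x <> p -> 0 < d x.
Proof. by move=> xp; rewrite normr_gt0 subr_eq0; apply/eqP => /val_inj. Qed.

Lemma distance_continuous : continuous d.
Proof.
have h : continuous (fun x : T => val x - val p).
  move=> x; apply: (@continuousB _ _ _ (val : T -> R) (cst (val p))); last exact: cst_continuous.
  exact: val_continuous.
by move=> x; exact: (cvg_norm (h x)).
Qed.

Lemma open_distance_lt r : open [set x : T | d x < r].
Proof. exact: (continuousP _).1 distance_continuous _ (@open_lt R r). Qed.

Lemma open_distance_gt r : open [set x : T | r < d x].
Proof. exact: (continuousP _).1 distance_continuous _ (@open_gt R r). Qed.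

Lemma missing_dense (a b : R) : a < b -> exists2 r, ~ G r & a < r < b.
Proof.
move=> ab; have [|g Gg /andP[h1 h2]] := @dense (c - b) (c - a); first by lra.
exists (c - g); last by apply/andP; split; lra.
by apply: contra_not Gc => /(subgroupD hG)/(_ Gg); rewrite addrNK.
Qed.

(** By density there are points other than [p] as near to [p] as wanted, and by
    continuity [f] keeps them near; either such a point or its image is moved up. *)
Lemma smaller_radius (s : R) : 0 < s -> exists r : R,
  [/\ ~ G r, 0 < r, r < s / 2 & exists x : T, [/\ moved_up f x, r < d x & d x < s]].
Proof.
move=> s0.
have [x [xU xs]] : exists x, moved_up f x /\ d x < s.
  have Hf := half_moved_up fc ff fp.
  have op : nbhs p (f @^-1` [set x | d x < s]).
    apply: fc; apply: open_nbhs_nbhs; split; first exact: open_distance_lt.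
    by rewrite /= fp.1 subrr normr0.
  have /nbhs_subgroupP[e e0 He] := op.
  have [|g Gg /andP[g1 g2]] := @dense (val p) (val p + Num.min e s).
    by rewrite ltrDl lt_min e0.
  pose y : T := SigSub (mem_set Gg).
  have [ye ys] : d y < e /\ d y < s.
    have : d y < Num.min e s by rewrite gtr0_norm /= ?subr_gt0 // ltrBlDl.
    by rewrite lt_min => /andP.
  have yp : y <> p by move=> /(congr1 val) /= E; rewrite E ltxx in g1.
  have [|] := half_cover Hf yp; first by exists y.
  by exists (f y); split => //; apply: He; rewrite distrC.
have xp : x <> p by move=> E; rewrite E /moved_up /= fp.1 ltxx in xU.
have [|r Gr /andP[r0]] := @missing_dense 0 (Num.min (d x) (s / 2)).
  by rewrite lt_min distance_gt0 // divr_gt0.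
by rewrite lt_min => /andP[r1 r2]; exists r; split => //; exists x.
Qed.

(** The first annulus is unbounded, so that the annuli cover the whole half. *)
Definition annulus (r : nat -> R) n : set T :=
  [set x | [/\ moved_up f x, r n < d x & if n is m.+1 then d x < r m else True]].

(** Distances to [p] lie in [G] and the radii do not, so strict and non-strict
    inequalities agree; and [p], the only point not moved, is far from the
    annulus. *)
Lemma clopen_annulus r n : (forall m, ~ G (r m)) -> (forall m, 0 < r m) -> clopen (annulus r n).
Proof.
move=> Gr r0.
have Hf := half_moved_up fc ff fp.
have -> : annulus r n = moved_up f `&` [set x : T | r n < d x] `&`
    (if n is m.+1 then [set x : T | d x < r m] else setT).
  by case: n => [|n]; apply/seteqP; split=> x; [case|move=> [[]]|case|move=> [[]]].
split.
  apply: openI; last by case: n => [|n]; [exact: openT|exact: open_distance_lt].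
  by apply: openI; [exact: half_open Hf|exact: open_distance_gt].
have dr x m : d x != r m.
  by apply/eqP => E; apply: (Gr m); rewrite -E; apply: distance_subgroup.
have -> : moved_up f `&` [set x : T | r n < d x] =
    ~` [set x | val (f x) < val x] `&` ~` [set x | d x < r n].
  apply/seteqP; split=> x.
    by move=> [/= /ltW h1 /ltW h2]; split; apply/negP; rewrite -leNgt.
  move=> [/negP h1 /negP h2]; rewrite -!leNgt in h1 h2.
  have h3 : r n < d x by rewrite lt_neqAle h2 eq_sym dr.
  split => //; rewrite /moved_up /= lt_neqAle h1 andbT; apply/eqP => /val_inj E.
  by move: h3; rewrite -(fp.2 _ (esym E)) subrr normr0 ltNge ltW.
apply: closedI.
  apply: closedI; apply: open_closedC; last exact: open_distance_lt.
  by apply: open_val_lt2 => // x; exact: cvg_id.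
case: n => [|n]; first exact: closedT.
rewrite (_ : [set x : T | d x < r n] = ~` [set x | r n < d x]).
  by apply: open_closedC; exact: open_distance_gt.
apply/seteqP; split=> x /=; first by move/ltW => h; apply/negP; rewrite -leNgt.
by move/negP; rewrite -leNgt lt_neqAle dr.
Qed.

(** The last two properties say that the pieces converge to [p]: late pieces are
    near [p], and points near [p] are in late pieces.  They are all that is
    needed to make a matching of the pieces of two involutions continuous at the
    fixed points. *)
Lemma annular_decomposition : exists P : nat -> set T,
  [/\ (forall n, clopen (P n) /\ P n !=set0), trivIset setT P,
      moved_up f = \bigcup_n P n,
      (forall N, nbhs p N -> exists n, forall m, (n <= m)%N -> P m `<=` N) &
      (forall n, \forall x \near p, forall m, P m x -> (n <= m)%N)].
Proof.
have /choice[g Hg] : forall s : R, exists r : R, 0 < s ->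
    [/\ ~ G r, 0 < r, r < s / 2 & exists x : T, [/\ moved_up f x, r < d x & d x < s]].
  move=> s; have [/smaller_radius[r Hr]|_] := ltP 0 s; first by exists r.
  by exists 0.
pose r n := iter n.+1 g 1.
have r0 n : 0 < r n.
  by elim: n => [|n IH]; [have [] := Hg _ ltr01|have [] := Hg _ IH].
have Gr n : ~ G (r n) by case: n => [|n]; [have [] := Hg _ ltr01|have [] := Hg _ (r0 n)].
have rS n : r n.+1 < r n / 2 by have [] := Hg _ (r0 n).
have rle n m : (n <= m)%N -> r m <= r n.
  elim: m => [|m IH]; first by rewrite leqn0 => /eqP->.
  rewrite leq_eqVlt => /orP[/eqP->//|/IH h].
  by have := rS m; have := r0 m; lra.
have rsmall eps : 0 < eps -> exists n, r n < eps.
  move=> e0; have r2 n : r n * n.+1%:R < 1.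
    suff : r n * 2 ^+ n < 1.
      apply: le_lt_trans; rewrite ler_pM2l //.
      by rewrite -natrX ler_nat ltn_expl.
    elim: n => [|n IH].
      by rewrite mulr1; have [_ _ h _] := Hg _ ltr01; rewrite /r /=; lra.
    by apply: lt_trans IH; rewrite exprS mulrA ltr_pM2r ?exprn_gt0 // -ltr_pdivlMr.
  have /Num.Theory.truncn_itv/andP[_ h] : 0 <= eps^-1 by rewrite invr_ge0 ltW.
  exists (Num.trunc eps^-1); set n := Num.trunc _ in h *.
  rewrite -(ltr_pM2r (ltr0Sn R n)); apply: lt_trans (r2 n) _.
  by rewrite -ltr_pdivrMl // mulr1.
exists (annulus r); split.
- move=> n; split; first exact: clopen_annulus.
  case: n => [|n]; last by have [_ _ _ [x [h1 h2 h3]]] := Hg _ (r0 n); exists x.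
  by have [_ _ _ [x [h1 h2 h3]]] := Hg _ ltr01; exists x.
- have aux i j x : (i < j)%N -> annulus r i x -> ~ annulus r j x.
    case: j => // j ij [_ h1 _] [_ _ h2].
    by have := rle i j ij; rewrite leNgt (lt_trans h1 h2).
  move=> i j _ _ [x [xi xj]]; have [ij|ji|//] := ltngtP i j.
    by case: (aux _ _ _ ij xi xj).
  by case: (aux _ _ _ ji xj xi).
- apply/seteqP; split=> x; last by move=> [n _ []].
  move=> xU; have xp : x <> p by move=> E; rewrite E /moved_up /= fp.1 ltxx in xU.
  have ex : exists n, r n < d x by apply: rsmall; apply: distance_gt0.
  case: (ex_minnP ex) => n h1 h2; exists n => //; split => //.
  case: n h1 h2 => // n _ h2; rewrite lt_neqAle; apply/andP; split.
    by apply/eqP => E; apply: (Gr n); rewrite -E; apply: distance_subgroup.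
  by rewrite leNgt; apply/negP => /h2; rewrite ltnn.
- move=> N /nbhs_subgroupP[e e0 He]; have [n rn] := rsmall _ e0.
  exists n.+1 => -[//|m] nm x [_ _ h]; apply: He; rewrite distrC.
  apply: lt_trans h _; apply: le_lt_trans rn; exact: rle.
- move=> n; have : nbhs p [set x : T | d x < r n].
    apply: open_nbhs_nbhs; split; first exact: open_distance_lt.
    by rewrite /= subrr normr0.
  apply: filterS => x /= dx m [_ h _]; rewrite leqNgt; apply/negP => mn.
  by have := rle _ _ (ltnW mn); rewrite leNgt (lt_trans h dx).
Qed.
End AnnularDecomposition.

Lemma conjugate_to_opp_dense (R : realType) (G : set R) (hG : zmod_closed (mem G))
    (f : G -> G) (p : G) c :
  (forall a b : R, a < b -> exists2 g, G g & a < g < b) -> ~ G c ->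
  sigma_compact G -> continuous f -> involutive f -> unique (fun x => f x = x) p ->
  exists phi psi : G -> G, [/\ cancel phi psi, cancel psi phi,
    continuous phi, continuous psi & forall x, phi (f x) = subgroup_opp hG (phi x)].
Proof.
move=> dense Gc sG fc ff fp.
have oc := @subgroup_opp_continuous _ _ hG; have oo := @subgroup_oppK _ _ hG.
have op := subgroup_opp_fixed hG.
have [P [clP tP UP Pp pP]] := annular_decomposition hG dense Gc fc ff fp.
have [Q [clQ tQ UQ Qp pQ]] := annular_decomposition hG dense Gc oc oo op.
have /choice[h /choice[k Hhk]] : forall n, exists h k, homeo_between (P n) (Q n) h k.
  move=> n; apply: (clopen_homeomorphic hG dense Gc sG).
  - by case: (clP n).
  - by case: (clQ n).
  - by case: (clP n).
  - by case: (clQ n).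
have Hf := half_moved_up fc ff fp; have Ho := half_moved_up oc oo op.
have H : homeo_between (moved_up f) (moved_up (subgroup_opp hG)) (glue 0%N P h) (glue 0%N Q k).
  rewrite UP UQ; apply: homeo_bigcup => // n; first by case: (clP n) => -[].
  by case: (clQ n) => -[].
apply: (involutions_conjugate Hf Ho H).
- move=> N /Qp[n Hn]; apply: filterS (pP n) => x Hx; rewrite UP => -[m _ Pm].
  rewrite (glueE _ _ tP Pm); apply: (Hn m); first exact: Hx.
  exact: (homeo_sub (Hhk m)).
- move=> N /Pp[n Hn]; apply: filterS (pQ n) => x Hx; rewrite UQ => -[m _ Qm].
  rewrite (glueE _ _ tQ Qm); apply: (Hn m); first exact: Hx.
  exact: (homeo_sub' (Hhk m)).
Qed.

(** * Discrete subgroups, the whole line, and the conclusion *)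

Section DiscreteSubgroup.
Variables (R : realType) (G : set R) (hG : zmod_closed (mem G)).
Local Notation T := (set_type G).
Variable e : R.
Hypotheses (e0 : 0 < e) (gap : forall g, G g -> 0 < g -> e <= g).

Lemma gap_eq (x y : T) : `|val x - val y| < e -> x = y.
Proof.
wlog xy : x y / val x < val y => [H xye|].
  have [xy|xy|/val_inj//] := ltgtP (val x) (val y); first exact: H.
  by apply/esym/H => //; rewrite distrC.
have := gap (subgroupB hG (val_subgroup y) (val_subgroup x)).
by rewrite subr_gt0 distrC gtr0_norm ?subr_gt0 // => /(_ xy); rewrite leNgt => /negP.
Qed.

Lemma nbhs_gap (x : T) : nbhs x [set x].
Proof. by apply/nbhs_subgroupP; exists e => // y /gap_eq. Qed.

Lemma gap_continuous (X : topologicalType) (h : T -> X) : continuous h.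
Proof.
move=> x N Nhx; apply: filterS (nbhs_gap x) => _ ->.
exact: nbhs_singleton Nhx.
Qed.

(** Distinct points are at least [e] apart, so rounding the quotient by [e] down
    is injective. *)
Lemma gap_countable (A : set T) : countable A.
Proof.
apply/countable_injP; exists (fun x => pickle (Num.floor (val x / e))) => x y _ _.
move=> /(pcan_inj pickleK) E; apply: gap_eq.
have := floor_itv (val x / e); have := floor_itv (val y / e).
rewrite E; set n := Num.floor _; rewrite intrD.
rewrite !ler_pdivlMr // !ltr_pdivrMr // mulrDl mul1r => /andP[h1 h2] /andP[h3 h4].
by rewrite ltr_norml; apply/andP; split; lra.
Qed.

(** The multiples of [g] make [G] infinite, and [G] is the union of the fixed
    point and of two copies of the half. *)
Lemma infinite_moved_up (f : T -> T) p g : G g -> g <> 0 ->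
  half_of_involution f p (moved_up f) -> infinite_set (moved_up f).
Proof.
move=> Gg g0 Hf finU.
have : finite_set [set: T].
  apply: (@sub_finite_set _ _ ([set p] `|` (moved_up f `|` f @` moved_up f))).
    move=> x _; case: (half_cases Hf x) => [->|Ux|Ux]; [by left|by right; left|right; right].
    by exists (f x) => //; rewrite (halfK Hf).
  by rewrite !finite_setU; split => //; split => //; apply: finite_image.
pose m n : T := SigSub (mem_set (subgroupMn hG n Gg)).
move=> /(@finite_preimage _ _ _ m) H; apply: infinite_nat; apply: H => i j _ _ /(congr1 val) /=.
by move/(mulIf (introN eqP g0))/eqP; rewrite eqr_nat => /eqP.
Qed.

Lemma conjugate_to_opp_discrete (f : T -> T) (p : T) :
  continuous f -> involutive f -> unique (fun x => f x = x) p ->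
  exists phi psi : G -> G, [/\ cancel phi psi, cancel psi phi,
    continuous phi, continuous psi & forall x, phi (f x) = subgroup_opp hG (phi x)].
Proof.
move=> fc ff fp.
have Hf := half_moved_up fc ff fp.
have Ho := half_moved_up (@subgroup_opp_continuous _ _ hG) (@subgroup_oppK _ _ hG)
  (subgroup_opp_fixed hG).
have [[g Gg g0]|triv] := pselect (exists2 g, G g & g <> 0); last first.
  exists id, id; split; [by []|by []|exact: gap_continuous|exact: gap_continuous|].
  move=> x; apply: val_inj.
  have Z (y : T) : val y = 0.
    by apply: contrapT => h; apply: triv; exists (val y) => //; apply: val_subgroup.
  by rewrite !Z.
have enum (U : set T) : infinite_set U -> exists (a : T -> nat) (b : nat -> T),
    [/\ forall n, U (b n), cancel b a & forall x, U x -> b (a x) = x].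
  move=> infU; have /card_set_bijP[a [_ ainj asurj]] := eq_card_nat (gap_countable U) infU.
  have /choice[b Hb] : forall n, exists x, U x /\ a x = n.
    by move=> n; have [x Ux <-] := asurj n Logic.I; exists x.
  exists a, b; split => [n|n|x Ux]; [by case: (Hb n)|by case: (Hb n)|].
  by have [Ub ab] := Hb (a x); apply: ainj => //; apply: mem_set.
have [a [b [Ub ab ba]]] := enum _ (infinite_moved_up Gg g0 Hf).
have [a' [b' [Ub' ab' ba']]] := enum _ (infinite_moved_up Gg g0 Ho).
apply: (involutions_conjugate Hf Ho (h := b' \o a) (k := b \o a')).
- split => /=.
  + by move=> x _; apply: Ub'.
  + by move=> x _; apply: Ub.
  + by move=> x Ux; rewrite ab' ba.
  + by move=> x Ux; rewrite ab ba'.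
  + by move=> x _; apply: gap_continuous.
  + by move=> x _; apply: gap_continuous.
- by move=> N _; apply: filterS (nbhs_gap p) => _ -> /(half_center Hf).
- by move=> N _; apply: filterS (nbhs_gap _) => _ -> /(half_center Ho).
Qed.

End DiscreteSubgroup.

Section WholeLine.
Variables (R : realType) (G : set R) (hG : zmod_closed (mem G)).
Local Notation T := (set_type G).
Hypothesis GT : forall r, G r.

(** If [x < f x], then [f] minus the identity changes sign between [x] and [f x],
    which [f] exchanges; the zero in between can only be [p], so [x < p <= f x].
    If [x < p] were not moved up, its image would be, and then [p <= x]. *)
Lemma moved_up_line (f : T -> T) (p : T) :
  continuous f -> involutive f -> unique (fun x => f x = x) p ->
  moved_up f = [set x | val x < val p].
Proof.
move=> fc ff fp.
have Hf := half_moved_up fc ff fp.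
pose toT (r : R) : T := SigSub (mem_set (GT r)).
have toTK (x : T) : toT (val x) = x by apply: val_inj.
have toTc : continuous toT by apply: continuous_into_subgroup => r; exact: cvg_id.
pose F (r : R) := val (f (toT r)) - r.
have Fc : continuous F.
  move=> r; apply: (@continuousB _ _ _ (fun r => val (f (toT r))) id); last exact: cvg_id.
  apply: (@continuous_comp _ _ _ toT (fun x => val (f x))); first exact: toTc.
  by apply: continuous_comp; [exact: fc|exact: val_continuous].
have up x : moved_up f x -> val x < val p /\ val p <= val (f x).
  move=> xU; have xfx := ltW xU.
  have [||r rI Fr] := @IVT R F (val x) (val (f x)) 0 xfx.
  - exact: continuous_subspaceT.
  - rewrite /F !toTK ff ge_min le_max.
    by rewrite !subr_le0 !subr_ge0 xfx orbT.
  have rp : toT r = p.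
    by apply/esym/fp.2/val_inj => /=; apply/eqP; rewrite -subr_eq0; apply/eqP.
  move: rI; rewrite in_itv /= -rp => /andP[xr rfx]; split => //.
  rewrite lt_neqAle xr andbT.
  apply/eqP => E; apply: (half_center Hf); rewrite -rp (_ : toT r = x) //.
  exact/val_inj/esym.
apply/seteqP; split=> x; first by case/up.
move=> /= xp; have /(half_cover Hf)[//|/up[_]] : x <> p.
  by move=> E; rewrite E ltxx in xp.
by rewrite ff leNgt xp.
Qed.

Lemma conjugate_to_opp_line (f : T -> T) (p : T) :
  continuous f -> involutive f -> unique (fun x => f x = x) p ->
  exists phi psi : G -> G, [/\ cancel phi psi, cancel psi phi,
    continuous phi, continuous psi & forall x, phi (f x) = subgroup_opp hG (phi x)].
Proof.
move=> fc ff fp.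
have oc := @subgroup_opp_continuous _ _ hG; have oo := @subgroup_oppK _ _ hG.
have op := subgroup_opp_fixed hG.
have Hf := half_moved_up fc ff fp; have Ho := half_moved_up oc oo op.
have Gp := val_subgroup p; have Gp' := subgroupN hG Gp.
apply: (involutions_conjugate Hf Ho (h := translation hG Gp') (k := translation hG Gp)).
- rewrite (moved_up_line fc ff fp) (moved_up_line oc oo op).
  split.
  + by move=> x /=; rewrite subr_lt0.
  + by move=> x /=; rewrite gtrDr.
  + by move=> x _; apply: val_inj; rewrite /= addrNK.
  + by move=> x _; apply: val_inj; rewrite /= addrK.
  + by move=> x _; apply: translation_continuous.
  + by move=> x _; apply: translation_continuous.
- move=> N N0; have : nbhs p (translation hG Gp' @^-1` N).
    apply: translation_continuous; rewrite (_ : translation hG Gp' p = subgroup_zero hG) //.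
    by apply: val_inj; rewrite /= subrr.
  by apply: filterS => x.
- move=> N N0; have : nbhs (subgroup_zero hG) (translation hG Gp @^-1` N).
    apply: translation_continuous; rewrite (_ : translation hG Gp _ = p) //.
    by apply: val_inj; rewrite /= add0r.
  by apply: filterS => x.
Qed.

End WholeLine.

(** With positive elements of [G] below any bound, multiples of a small one fall
    in any given interval. *)
Lemma subgroup_dense_or_gap (R : realType) (G : set R) (hG : zmod_closed (mem G)) :
  (forall a b : R, a < b -> exists2 g, G g & a < g < b) \/
  (exists2 e, 0 < e & forall g, G g -> 0 < g -> e <= g).
Proof.
have [[e e0 He]|H] := pselect (exists2 e, 0 < e & forall g, G g -> 0 < g -> e <= g).
  by right; exists e.
left=> a b ab.
have [g Gg /andP[g0 gab]] : exists2 g, G g & 0 < g < b - a.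
  apply: contrapT => H'; apply: H; exists (b - a); first by rewrite subr_gt0.
  move=> g Gg g0; rewrite leNgt; apply/negP => gab; apply: H'; exists g => //.
  by rewrite g0.
have := floor_itv (a / g); set n := Num.floor _.
rewrite intrD ler_pdivlMr // ltr_pdivrMr // mulrDl mul1r => /andP[h1 h2].
exists (n%:~R * g + g); last by apply/andP; split; lra.
apply: (subgroupD hG) => //.
clearbody n; case: (intP n) => [|m|m]; first by rewrite mul0r; apply: subgroup0.
  exact: (subgroupMn hG m.+1 Gg).
by rewrite mulrNz mulNr; apply: (subgroupN hG); apply: (subgroupMn hG m.+1 Gg).
Qed.

Lemma transport_group_structure (R : realType) (G : set R) (hG : zmod_closed (mem G))
    (f phi psi : G -> G) :
  cancel phi psi -> cancel psi phi -> continuous phi -> continuous psi ->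
  (forall x, phi (f x) = subgroup_opp hG (phi x)) -> continuous f ->
  exists (op : G -> G -> G) (e : G) (inv : G -> G),
    [/\ is_topological_group op e inv,
        topologically_isomorphic op (subgroup_add hG) & f =1 inv].
Proof.
move=> phiK psiK phic psic fphi fc.
have valD (x y : G) : val (subgroup_add hG x y) = val x + val y by [].
exists (fun x y => psi (subgroup_add hG (phi x) (phi y))), (psi (subgroup_zero hG)), f.
split => //; last first.
  by exists phi, psi; split => // x y; rewrite psiK.
split => //.
- by move=> x y z; congr psi; apply: val_inj; rewrite !(valD, psiK) addrA.
- by move=> x; rewrite -[RHS]phiK; congr psi; apply: val_inj; rewrite valD psiK /= add0r.
- by move=> x; rewrite -[RHS]phiK; congr psi; apply: val_inj; rewrite valD psiK /= addr0.
- by move=> x; congr psi; apply: val_inj; rewrite valD fphi /= addNr.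
- by move=> x; congr psi; apply: val_inj; rewrite valD fphi /= addrN.
- have addc : continuous (fun z : G * G => subgroup_add hG (phi z.1) (phi z.2)).
    apply: continuous_into_subgroup => z.
    apply: (@continuousD _ _ _ (fun z : G * G => val (phi z.1)) (fun z : G * G => val (phi z.2))).
      apply: (@continuous_comp _ _ _ fst (fun x => val (phi x))); first exact: cvg_fst.
      by apply: continuous_comp; [exact: phic|exact: val_continuous].
    apply: (@continuous_comp _ _ _ snd (fun x => val (phi x))); first exact: cvg_snd.
    by apply: continuous_comp; [exact: phic|exact: val_continuous].
  move=> z; apply: (@continuous_comp _ _ _ (fun z : G * G => subgroup_add hG (phi z.1) (phi z.2)) psi).
    exact: addc.
  exact: psic.
Qed.

(* G used as a type is the subtype set_type G, whose topology is the
   subspace topology induced by R. *)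
Theorem theorem3p1 (R : realType) (G : set R) (hG : zmod_closed (mem G))
    (G_sigma_compact : sigma_compact G)
    (f : G -> G) (f_continuous : continuous f) (f_involutive : involutive f)
    (f_fixed : exists! x : G, f x = x) :
  exists (op : G -> G -> G) (e : G) (inv : G -> G),
    [/\ is_topological_group op e inv,
        topologically_isomorphic op (subgroup_add hG) &
        f =1 inv].
Proof.
have [p fp] := f_fixed.
have [phi [psi [phiK psiK phic psic fphi]]] : exists phi psi : G -> G,
    [/\ cancel phi psi, cancel psi phi, continuous phi, continuous psi &
        forall x, phi (f x) = subgroup_opp hG (phi x)].
  have [dense|[e e0 gap]] := subgroup_dense_or_gap hG; last first.
    exact: (conjugate_to_opp_discrete hG e0 gap f_continuous f_involutive fp).
  have [GT|/existsNP[c Gc]] := pselect (forall r, G r).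
    exact: (conjugate_to_opp_line hG GT f_continuous f_involutive fp).
  exact: (conjugate_to_opp_dense hG dense Gc G_sigma_compact f_continuous
    f_involutive fp).
exact: (transport_group_structure phiK psiK phic psic fphi f_continuous).
Qed.
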